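(* Let $O=(0,0)$ and let $P=(x,y)$, with $0<x<1$, be a point of the planar interception curve (defined in the context). Let $Q$ be the point where the line $OP$ meets the line $X=1$. Suppose that the tangent line of the curve at the point $P$ intersects the $x$-axis, the $y$-axis and the line $X=1$ at the points $F$, $U$ and $T$, respectively. Then (1) $|UP|=|OU|+|TQ|$; (2) $(1-x)\cdot|UP|=|TQ|$; (3) $x\cdot|PT|=|TQ|$; (4) $\sin\angle QPT=|OP|\cdot\sin^2\angle TQP$, where $x$ is the abscissa of the point $P(x,y)$.
   Context: The planar interception curve is the graph of the function $y=y(x)$, $0\le x<1$, starting at the origin, such that the arc length of the curve from $O$ to $P=(x,y(x))$ equals the length $y/x$ of the segment $AQ$ for $0<x<1$, where $A=(1,0)$ and $Q=(1,y/x)$ is the point of the line $X=1$ on the ray $OP$: $\int_0^x\sqrt{1+(y'(t))^2}\,dt=y/x$. Equivalently, it satisfies the differential equation $x^2\sqrt{1+(y'(x))^2}=x\,y'(x)-y(x)$ with $y(0)=0$, and is parametrized by the slope $p=y'(x)\ge 0$ as $$x(p)=\frac{1}{\sqrt[4]{p^2+1}}\int_0^p\frac{dt}{2\sqrt[4]{t^2+1}},\qquad y(p)=p\,x(p)-(x(p))^2\sqrt{p^2+1}\quad(p\ge 0).$$ $|XY|$ denotes the Euclidean distance between points $X$ and $Y$. *)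

(* Defs.v *)
From Stdlib Require Import Reals.
From Coquelicot Require Import Coquelicot.
Open Scope R_scope.

Definition point : Type := (R * R)%type.

Definition origin : point := (0, 0).

Definition pdist (A B : point) : R :=
  dist_euc (fst A) (snd A) (fst B) (snd B).

(* The line through A and B (meaningful for A <> B). *)
Definition on_line (A B M : point) : Prop :=
  exists t : R,
    M = (fst A + t * (fst B - fst A), snd A + t * (snd B - snd A)).

Definition on_x_axis (M : point) : Prop := snd M = 0.
Definition on_y_axis (M : point) : Prop := fst M = 0.
Definition on_line_X1 (M : point) : Prop := fst M = 1.

(* The angle ABC at the vertex B, in [0, PI] (meaningful for A <> B and
   C <> B). *)
Definition angle (A B C : point) : R :=
  acos (((fst A - fst B) * (fst C - fst B)
         + (snd A - snd B) * (snd C - snd B))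
        / (pdist B A * pdist B C)).

(* The tangent line at (x, y x) to the graph of a function y that is
   differentiable at x. *)
Definition on_tangent (y : R -> R) (x : R) (M : point) : Prop :=
  snd M = y x + Derive y x * (fst M - x).

(* L is the length of the graph of y over [a, b]. The integrand at the
   endpoints does not matter, so y need only be differentiable inside. *)
Definition is_arc_length (y : R -> R) (a b L : R) : Prop :=
  is_RInt (fun t => sqrt (1 + (Derive y t) ^ 2)) a b L.

(* Only the values of y on [0, 1) are constrained. The initial slope is not
   prescribed: the arc length condition forces y x / x to tend to 0 as x tends
   to 0 from the right. By contrast, x^2 sqrt (1 + y'^2) = x y' - y with
   y 0 = 0 alone leaves the initial slope free. *)
Definition interception_curve (y : R -> R) : Prop :=
  y 0 = 0 /\
  (forall x : R, 0 < x < 1 -> ex_derive y x) /\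
  (forall x : R, 0 < x < 1 -> is_arc_length y 0 x (y x / x)).

(* Main.v *)
Require Import Defs.
From Stdlib Require Import Reals Psatz.
From Coquelicot Require Import Coquelicot.
Open Scope R_scope.

(** Write [p] for the slope [y'(x)] and [s = sqrt (1 + p^2)].  Everything
    follows from the differential equation [y x = x * p - x^2 * s]: the line
    [OP] meets [X = 1] at [Q = (1, y x / x)] and the tangent meets the vertical
    lines at [U = (0, - x^2 * s)] and [T = (1, y x + p * (1 - x))], so that
    [|OU| = x^2 s], [|UP| = x s], [|TQ| = x (1 - x) s] and [|PT| = (1 - x) s].
    The relations between lengths are read off from these values.  For the
    angles, the law of sines in the triangle [QPT] and [x * |PT| = |TQ|] give
    [sin QPT = x * sin TQP], and [sin TQP = x / |OP|] because [QT] is vertical.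

    The delicate point is the differential equation itself.  Differentiating
    the arc length condition would give it at once if [y'] were continuous, but
    [y] is only assumed differentiable, with an integrable length density
    [f = sqrt (1 + y'^2)].  Let [G t = y t / t], whose increments are the
    integrals of [f], and let [g = G'].  Difference quotients of [G] are mean
    values of [f], so on every interval [g] stays between the infimum and the
    supremum of [f].  On the other hand [y' t = t * g t + G t], and
    [sqrt (1 + p^2)] is 1-Lipschitz in [p], so the oscillation of [f] on a short
    interval is at most [q] times that of [g] plus a multiple of the length,
    for some [q < 1] since [t < 1].  Together these bound the oscillation [w] of
    [f] by [q * w] plus a multiple of the length, so [w] is at most a multiple
    of the length.  As [f] and [g] lie between the same bounds, [|f - g| <= w];
    letting the interval shrink gives [f = g] everywhere ([contractive_density_eq]). *)

(** * Derivatives and contractive densities *)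

Lemma derivative_ge_of_slopes (G : R -> R) (a b t l m : R) :
  a < t < b -> is_derive G t l ->
  (forall u v, a < u -> u < v -> v < b -> m * (v - u) <= G v - G u) ->
  m <= l.
Proof.
intros Ht HG Hm.
destruct (Rle_or_lt m l) as [H | H]; [exact H | exfalso].
apply is_derive_Reals in HG.
destruct (HG (m - l)) as [[d Hd] HD]; [lra |]. simpl in HD.
set (h := Rmin d (b - t) / 2).
assert (Hh : 0 < h /\ h < d /\ h < b - t).
{ unfold h, Rmin; destruct (Rle_dec d (b - t)); lra. }
assert (H1 := HD h ltac:(lra) ltac:(rewrite Rabs_pos_eq; lra)).
apply Rabs_def2 in H1. destruct H1 as [H1 _].
assert (H2 := Hm t (t + h) ltac:(lra) ltac:(lra) ltac:(lra)).
assert (H3 : (G (t + h) - G t) / h < m) by lra.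
apply (Rmult_lt_compat_r h) in H3; [| lra].
replace ((G (t + h) - G t) / h * h) with (G (t + h) - G t) in H3 by (field; lra).
nra.
Qed.

Lemma derivative_between_slopes (G : R -> R) (a b t l m M : R) :
  a < t < b -> is_derive G t l ->
  (forall u v, a < u -> u < v -> v < b ->
     m * (v - u) <= G v - G u <= M * (v - u)) ->
  m <= l <= M.
Proof.
intros Ht HG H. split.
- apply (derivative_ge_of_slopes G a b t l m Ht HG).
  intros u v Hu Huv Hv. apply (H u v Hu Huv Hv).
- enough (- M <= - l) by lra.
  apply (derivative_ge_of_slopes (fun u => - G u) a b t (- l) (- M) Ht).
  + apply (is_derive_opp G t l HG).
  + intros u v Hu Huv Hv. assert (H1 := H u v Hu Huv Hv). lra.
Qed.

Lemma is_RInt_between (f : R -> R) (u v I m M : R) :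
  u < v -> is_RInt f u v I -> (forall t, u < t < v -> m <= f t <= M) ->
  m * (v - u) <= I <= M * (v - u).
Proof.
intros Huv HI Hf.
assert (Hc : forall k : R, is_RInt (fun _ => k) u v (k * (v - u))).
{ intro k. rewrite Rmult_comm. apply (is_RInt_const (V := R_NormedModule)). }
split.
- apply (is_RInt_le (fun _ => m) f u v); [lra | apply Hc | exact HI |].
  intros t Ht. apply (Hf t Ht).
- apply (is_RInt_le f (fun _ => M) u v); [lra | exact HI | apply Hc |].
  intros t Ht. apply (Hf t Ht).
Qed.

(** No continuity of [f] is assumed: the derivative of a primitive of [f] is
    still a limit of mean values of [f]. *)
Lemma derivative_of_primitive_between (f G : R -> R) (a b t l m M : R) :
  a < t < b -> is_derive G t l ->
  (forall u v, a < u -> u < v -> v < b -> is_RInt f u v (G v - G u)) ->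
  (forall u, a < u < b -> m <= f u <= M) ->
  m <= l <= M.
Proof.
intros Ht HG HI Hf.
apply (derivative_between_slopes G a b t l m M Ht HG).
intros u v Hu Huv Hv.
apply (is_RInt_between f); [exact Huv | apply HI; assumption |].
intros w Hw. apply Hf. lra.
Qed.

Lemma inf_sup_on_interval (f : R -> R) (a b M : R) :
  a < b -> (forall t, a < t < b -> Rabs (f t) <= M) ->
  exists i s,
    (forall t, a < t < b -> i <= f t <= s) /\
    (forall k, (forall t, a < t < b -> f t <= k) -> s <= k) /\
    (forall k, (forall t, a < t < b -> k <= f t) -> k <= i).
Proof.
assert (Hsup : forall h : R -> R, a < b ->
  (forall t, a < t < b -> Rabs (h t) <= M) ->
  exists s, (forall t, a < t < b -> h t <= s) /\
    (forall k, (forall t, a < t < b -> h t <= k) -> s <= k)).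
{ intros h Hab Hh.
  destruct (completeness (fun z => exists t, a < t < b /\ z = h t)) as [s [H1 H2]].
  - exists M. intros z [t [Ht ->]].
    apply (Rle_trans _ (Rabs (h t))); [apply Rle_abs | apply Hh, Ht].
  - exists (h ((a + b) / 2)), ((a + b) / 2). split; [lra | reflexivity].
  - exists s. split.
    + intros t Ht. apply H1. exists t. split; [exact Ht | reflexivity].
    + intros k Hk. apply H2. intros z [t [Ht ->]]. apply Hk, Ht. }
intros Hab Hf.
destruct (Hsup f Hab Hf) as [s [Hs1 Hs2]].
destruct (Hsup (fun t => - f t) Hab) as [j [Hj1 Hj2]].
{ intros t Ht. rewrite Rabs_Ropp. apply Hf, Ht. }
exists (- j), s. split; [| split].
- intros t Ht. assert (H := Hj1 t Ht). simpl in H.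
  split; [lra | apply Hs1, Ht].
- exact Hs2.
- intros k Hk. enough (j <= - k) by lra.
  apply Hj2. intros t Ht. assert (H := Hk t Ht). lra.
Qed.

(** The oscillation [w] of [f] bounds that of [g], so the contraction hypothesis
    yields [w <= q * w + K * (b - a)]; and [f t], [g t] both lie between the
    bounds of [f]. *)
Lemma contractive_density_close (f g G : R -> R) (a b q K M : R) :
  q < 1 -> 0 <= q -> 0 <= K ->
  (forall t, a < t < b -> is_derive G t (g t)) ->
  (forall u v, a < u -> u < v -> v < b -> is_RInt f u v (G v - G u)) ->
  (forall t, a < t < b -> Rabs (f t) <= M) ->
  (forall u v, a < u < b -> a < v < b ->
     Rabs (f u - f v) <= q * Rabs (g u - g v) + K * Rabs (u - v)) ->
  forall t, a < t < b -> (1 - q) * Rabs (f t - g t) <= K * (b - a).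
Proof.
intros Hq1 Hq0 HK HG HI HM Hcon t Ht.
destruct (inf_sup_on_interval f a b M ltac:(lra) HM) as [i [s [His [Hs Hi]]]].
assert (Hg : forall u, a < u < b -> i <= g u <= s).
{ intros u Hu.
  apply (derivative_of_primitive_between f G a b u (g u) i s Hu (HG u Hu) HI His). }
assert (Hosc : forall u v, a < u < b -> a < v < b ->
  f u - f v <= q * (s - i) + K * (b - a)).
{ intros u v Hu Hv.
  apply (Rle_trans _ _ _ (Rle_abs _)), (Rle_trans _ _ _ (Hcon u v Hu Hv)).
  assert (H1 := Hg u Hu). assert (H2 := Hg v Hv).
  apply Rplus_le_compat; apply Rmult_le_compat_l; try assumption;
    apply Rabs_le; lra. }
assert (Hw : s - i <= q * (s - i) + K * (b - a)).
{ enough (s - (q * (s - i) + K * (b - a)) <= i) by lra.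
  apply Hi. intros v Hv.
  enough (s <= f v + (q * (s - i) + K * (b - a))) by lra.
  apply Hs. intros u Hu. assert (H := Hosc u v Hu Hv). lra. }
assert (Hfg : Rabs (f t - g t) <= s - i).
{ assert (H1 := His t Ht). assert (H2 := Hg t Ht). apply Rabs_le. lra. }
nra.
Qed.

(** A differentiable primitive need not have its integrand as derivative; it
    does when the integrand varies strictly less than that derivative, up to
    a Lipschitz term. *)
Lemma contractive_density_eq (f g G : R -> R) (c d q K : R) :
  q < 1 -> 0 <= q -> 0 <= K ->
  (forall t, c < t < d -> is_derive G t (g t)) ->
  (forall u v, c < u -> u < v -> v < d -> is_RInt f u v (G v - G u)) ->
  (forall u v, c < u < d -> c < v < d ->
     Rabs (f u - f v) <= q * Rabs (g u - g v) + K * Rabs (u - v)) ->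
  forall t, c < t < d -> f t = g t.
Proof.
intros Hq1 Hq0 HK HG HI Hcon t Ht.
apply Rminus_diag_uniq.
destruct (Req_dec (f t - g t) 0) as [H0 | H0]; [exact H0 | exfalso].
assert (Hp := Rabs_pos_lt _ H0).
set (e := Rabs (f t - g t)) in *.
set (r := Rmin (t - c) (d - t) / 2).
assert (Hr : 0 < r /\ c < t - r /\ t + r < d).
{ unfold r, Rmin; destruct (Rle_dec (t - c) (d - t)); lra. }
destruct (ex_RInt_ub (V := R_NormedModule) f (t - r) (t + r)) as [M HM].
{ exists (G (t + r) - G (t - r)). apply HI; lra. }
rewrite Rmin_left, Rmax_right in HM by lra.
(* On an interval of length 2h the closeness estimate would read
   (1 - q) * e <= 2 * K * h; the bound on h makes this fail, and the 1 added to
   2 * K covers the case K = 0. *)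
set (h := Rmin r ((1 - q) * e / (2 * K + 1) / 2)).
assert (Hz : 0 < (1 - q) * e / (2 * K + 1)).
{ apply Rdiv_lt_0_compat; [apply Rmult_lt_0_compat; lra | lra]. }
assert (Hz' : (1 - q) * e / (2 * K + 1) * (2 * K + 1) = (1 - q) * e)
  by (field; lra).
set (z := (1 - q) * e / (2 * K + 1)) in *.
assert (Hh : 0 < h /\ h <= r /\ h < z).
{ unfold h, Rmin. destruct (Rle_dec r (z / 2)); lra. }
assert (H := contractive_density_close f g G (t - h) (t + h) q K M Hq1 Hq0 HK).
assert (H1 : (1 - q) * e <= K * (t + h - (t - h))).
{ apply H.
  - intros u Hu. apply HG. lra.
  - intros u v Hu Huv Hv. apply HI; lra.
  - intros u Hu. apply (HM u). lra.
  - intros u v Hu Hv. apply Hcon; lra.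
  - lra. }
nra.
Qed.

(** * The differential equation of the interception curve *)

Lemma sqrt_1_plus_sq_lipschitz (a b : R) :
  Rabs (sqrt (1 + a ^ 2) - sqrt (1 + b ^ 2)) <= Rabs (a - b).
Proof.
assert (Ha := pow2_sqrt (1 + a ^ 2) ltac:(nra)).
assert (Hb := pow2_sqrt (1 + b ^ 2) ltac:(nra)).
assert (Pa := sqrt_pos (1 + a ^ 2)).
assert (Pb := sqrt_pos (1 + b ^ 2)).
set (A := sqrt (1 + a ^ 2)) in *.
set (B := sqrt (1 + b ^ 2)) in *.
apply Rsqr_le_abs_0. unfold Rsqr.
(* This is the Cauchy-Schwarz inequality for (1, a) and (1, b). *)
assert (1 + a * b <= A * B).
{ apply Rsqr_incr_0_var; [unfold Rsqr | nra].
  replace (A * B * (A * B)) with (A ^ 2 * B ^ 2) by ring.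
  rewrite Ha, Hb. assert (0 <= (a - b) ^ 2) by apply pow2_ge_0. nra. }
nra.
Qed.

Lemma sqrt_1_plus_sq_ge_1 (a : R) : 1 <= sqrt (1 + a ^ 2).
Proof.
rewrite <- sqrt_1 at 1. apply sqrt_le_1_alt. nra.
Qed.

(** The contraction factor is [d]: the slope is [t * g t + y t / t] with [t < d],
    and [sqrt (1 + p^2)] is 1-Lipschitz in [p]. *)
Lemma interception_curve_ode (y : R -> R) (x : R) :
  interception_curve y -> 0 < x < 1 ->
  y x = x * Derive y x - x ^ 2 * sqrt (1 + (Derive y x) ^ 2).
Proof.
intros [_ [Hdiff Hlen]] Hx.
set (f := fun t => sqrt (1 + (Derive y t) ^ 2)).
set (G := fun t => y t / t).
set (g := fun t => (Derive y t * t - y t * 1) / t ^ 2).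
set (c := x / 2). set (d := (1 + x) / 2).
assert (Hcd : 0 < c /\ c < x /\ x < d /\ d < 1) by (unfold c, d; lra).
clearbody c d.
assert (HG : forall t, 0 < t < 1 -> is_derive G t (g t)).
{ intros t Ht. apply (is_derive_div y (fun t => t) t (Derive y t) 1).
  - apply Derive_correct, Hdiff, Ht.
  - apply (is_derive_id (K := R_AbsRing)).
  - lra. }
assert (HI : forall u v, 0 < u -> u < v -> v < 1 -> is_RInt f u v (G v - G u)).
{ intros u v Hu Huv Hv.
  replace (G v - G u) with (plus (opp (G u)) (G v))
    by (unfold plus, opp; simpl; ring).
  apply (is_RInt_Chasles (V := R_NormedModule) f u 0 v).
  - apply (is_RInt_swap (V := R_NormedModule)), Hlen. lra.
  - apply Hlen. lra. }
destruct (ex_RInt_ub (V := R_NormedModule) f c d) as [M HM].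
{ exists (G d - G c). apply HI; lra. }
rewrite Rmin_left, Rmax_right in HM by lra.
assert (Hf : forall t, c < t < d -> 1 <= f t <= M).
{ intros t Ht. split; [apply sqrt_1_plus_sq_ge_1 |].
  apply (Rle_trans _ _ _ (Rle_abs _)), (HM t). lra. }
assert (Hg : forall t, c < t < d -> 1 <= g t <= M).
{ intros t Ht.
  apply (derivative_of_primitive_between f G c d t); try assumption.
  - apply HG. lra.
  - intros u v Hu Huv Hv. apply HI; lra. }
assert (HM1 : 1 <= M) by (assert (H := Hf x ltac:(lra)); lra).
assert (HGlip : forall u v, c < u < d -> c < v < d ->
  Rabs (G u - G v) <= M * Rabs (u - v)).
{ assert (Hlt : forall u v, c < u -> u < v -> v < d ->
    Rabs (G v - G u) <= M * (v - u)).
  { intros u v Hu Huv Hv.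
    assert (H := is_RInt_between f u v (G v - G u) 1 M Huv (HI u v ltac:(lra) Huv ltac:(lra))).
    apply Rabs_le.
    destruct H as [H1 H2]; [intros t Ht; apply Hf; lra |]. nra. }
  intros u v Hu Hv. destruct (Rtotal_order u v) as [H | [H | H]].
  - rewrite Rabs_minus_sym, (Rabs_minus_sym u), (Rabs_pos_eq (v - u)) by lra.
    apply Hlt; lra.
  - subst v. rewrite !Rminus_diag, Rabs_R0. lra.
  - rewrite (Rabs_pos_eq (u - v)) by lra. apply Hlt; lra. }
assert (Hp : forall t, c < t < d -> Derive y t = t * g t + G t).
{ intros t Ht. unfold g, G. field. lra. }
assert (Hfg : f x = g x).
{ apply (contractive_density_eq f g G c d d (2 * M)); try lra.
  - intros t Ht. apply HG. lra.
  - intros u v Hu Huv Hv. apply HI; lra.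
  - intros u v Hu Hv.
    apply (Rle_trans _ _ _ (sqrt_1_plus_sq_lipschitz _ _)).
    rewrite (Hp u Hu), (Hp v Hv).
    replace (u * g u + G u - (v * g v + G v))
      with (u * (g u - g v) + (u - v) * g v + (G u - G v)) by ring.
    apply (Rle_trans _ _ _ (Rabs_triang _ _)).
    apply (Rle_trans _ (Rabs (u * (g u - g v)) + Rabs ((u - v) * g v)
                        + Rabs (G u - G v))).
    { apply Rplus_le_compat_r, Rabs_triang. }
    rewrite !Rabs_mult, (Rabs_pos_eq u) by lra.
    assert (H1 := Hg v Hv). rewrite (Rabs_pos_eq (g v)) by lra.
    assert (H2 := HGlip u v Hu Hv).
    assert (H3 := Rabs_pos (g u - g v)). assert (H4 := Rabs_pos (u - v)).
    nra. }
unfold f, g in Hfg. rewrite Hfg. field. lra.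
Qed.

(** * Distances and angles in coordinates *)

Lemma pdist_eq (a b c d k : R) :
  0 <= k -> k ^ 2 = (c - a) ^ 2 + (d - b) ^ 2 -> pdist (a, b) (c, d) = k.
Proof.
intros Hk H. unfold pdist, dist_euc. simpl fst. simpl snd.
rewrite <- (sqrt_pow2 k Hk), H. f_equal. unfold Rsqr. ring.
Qed.

Lemma pdist_sqr (A B : point) :
  pdist A B ^ 2 = (fst B - fst A) ^ 2 + (snd B - snd A) ^ 2.
Proof.
unfold pdist, dist_euc. rewrite pow2_sqrt.
- unfold Rsqr. ring.
- apply Rplus_le_le_0_compat; apply Rle_0_sqr.
Qed.

(** Lagrange's identity: the squares of the dot product and of the
    determinant add up to the product of the squared lengths. *)
Lemma sin_angle (A B C : point) :
  0 < pdist B A -> 0 < pdist B C ->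
  sin (angle A B C) =
    Rabs ((fst A - fst B) * (snd C - snd B) - (snd A - snd B) * (fst C - fst B))
      / (pdist B A * pdist B C).
Proof.
intros HA HC. unfold angle.
assert (SA := pdist_sqr B A). assert (SC := pdist_sqr B C).
set (u := pdist B A) in *. set (v := pdist B C) in *.
set (a1 := fst A - fst B) in *. set (a2 := snd A - snd B) in *.
set (c1 := fst C - fst B) in *. set (c2 := snd C - snd B) in *.
assert (Huv : 0 < u * v) by (apply Rmult_lt_0_compat; assumption).
assert (Hid : 1 - ((a1 * c1 + a2 * c2) / (u * v))²
              = ((a1 * c2 - a2 * c1) / (u * v))²).
{ unfold Rsqr.
  assert (E : (u * v) ^ 2
     = (a1 * c1 + a2 * c2) ^ 2 + (a1 * c2 - a2 * c1) ^ 2).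
  { replace ((u * v) ^ 2) with (u ^ 2 * v ^ 2) by ring. rewrite SA, SC. ring. }
  replace 1 with ((u * v) ^ 2 / (u * v) ^ 2) by (field; lra).
  rewrite E at 1. field. lra. }
rewrite sin_acos.
- rewrite Hid, sqrt_Rsqr_abs. unfold Rdiv. rewrite Rabs_mult.
  f_equal. rewrite Rabs_pos_eq; [reflexivity |].
  left. apply Rinv_0_lt_compat, Huv.
- assert (H := Rle_0_sqr ((a1 * c2 - a2 * c1) / (u * v))).
  rewrite <- Hid in H. unfold Rsqr in H. nra.
Qed.

Theorem theorem1 (y : R -> R) (hy : interception_curve y)
    (x : R) (hx : 0 < x < 1)
    (P Q F U T : point)
    (hP : P = (x, y x))
    (hQ : on_line origin P Q /\ on_line_X1 Q)
    (hF : on_tangent y x F /\ on_x_axis F)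
    (hU : on_tangent y x U /\ on_y_axis U)
    (hT : on_tangent y x T /\ on_line_X1 T) :
  pdist U P = pdist origin U + pdist T Q /\
  (1 - x) * pdist U P = pdist T Q /\
  x * pdist P T = pdist T Q /\
  sin (angle Q P T) = pdist origin P * (sin (angle T Q P)) ^ 2.
Proof.
assert (Hode := interception_curve_ode y x hy hx).
clear hF hy.
destruct Q as [q1 q2], U as [u1 u2], T as [t1 t2].
unfold on_line, on_line_X1, on_tangent, on_y_axis, origin in *.
simpl in hQ, hU, hT.
destruct hU as [hU ->], hT as [hT ->], hQ as [[k hk] ->].
subst P. simpl in hk. injection hk as hk1 hk2.
set (p := Derive y x) in *.
assert (Hs := pow2_sqrt (1 + p ^ 2) ltac:(nra)).
assert (Hs1 := sqrt_1_plus_sq_ge_1 p).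
set (s := sqrt (1 + p ^ 2)) in *.
clearbody p s.
set (z := y x) in *. clearbody z.
assert (Hk : k = / x).
{ apply (Rmult_eq_reg_r x); [rewrite Rinv_l; lra | lra]. }
assert (Hq2 : q2 = p - x * s) by (rewrite hk2, Hk, Hode; field; lra).
assert (HOU : pdist (0, 0) (0, u2) = x ^ 2 * s)
  by (apply pdist_eq; [nra | rewrite hU, Hode; ring]).
assert (HUP : pdist (0, u2) (x, z) = x * s).
{ apply pdist_eq; [nra |]. rewrite hU.
  replace ((x * s) ^ 2) with (x ^ 2 * s ^ 2) by ring. rewrite Hs. ring. }
assert (Hsign : 0 <= x * (1 - x) * s)
  by (repeat apply Rmult_le_pos; lra).
assert (HTQ : pdist (1, t2) (1, q2) = x * (1 - x) * s)
  by (apply pdist_eq; [exact Hsign | rewrite hT, Hq2, Hode; ring]).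
assert (HQT : pdist (1, q2) (1, t2) = x * (1 - x) * s)
  by (apply pdist_eq; [exact Hsign | rewrite hT, Hq2, Hode; ring]).
assert (HPT : pdist (x, z) (1, t2) = (1 - x) * s).
{ apply pdist_eq; [nra |]. rewrite hT.
  replace (((1 - x) * s) ^ 2) with ((1 - x) ^ 2 * s ^ 2) by ring.
  rewrite Hs. ring. }
assert (HOP2 := pdist_sqr (0, 0) (x, z)). simpl fst in HOP2. simpl snd in HOP2.
assert (HOP : 0 < pdist (0, 0) (x, z)).
{ assert (H0 : 0 <= pdist (0, 0) (x, z)) by apply sqrt_pos. nra. }
set (r := pdist (0, 0) (x, z)) in *.
assert (Hzx : q2 = z / x) by (rewrite Hq2, Hode; field; lra).
assert (Hsc : 0 < (1 - x) / x) by (apply Rdiv_lt_0_compat; lra).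
assert (Hsc2 : ((1 - x) / x * r) ^ 2 = (1 - x) ^ 2 + (q2 - z) ^ 2).
{ replace (((1 - x) / x * r) ^ 2) with (((1 - x) / x) ^ 2 * r ^ 2) by ring.
  rewrite HOP2, Hzx. field. lra. }
assert (HPQ : pdist (x, z) (1, q2) = (1 - x) / x * r)
  by (apply pdist_eq; [nra | exact Hsc2]).
assert (HQP : pdist (1, q2) (x, z) = (1 - x) / x * r)
  by (apply pdist_eq; [nra | rewrite Hsc2; ring]).
rewrite HUP, HOU, HTQ, HPT.
assert (Hpos1 : 0 < (1 - x) * s) by (apply Rmult_lt_0_compat; lra).
assert (Hpos2 : 0 < x * (1 - x) * s)
  by (repeat apply Rmult_lt_0_compat; lra).
assert (Hpos3 : 0 < (1 - x) / x * r) by (apply Rmult_lt_0_compat; assumption).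
split; [ring |]. split; [ring |]. split; [ring |].
rewrite !sin_angle by (rewrite ?HPQ, ?HPT, ?HQT, ?HQP; assumption).
rewrite HPQ, HPT, HQT, HQP. simpl fst. simpl snd.
replace ((1 - x) * (t2 - z) - (q2 - z) * (1 - x)) with ((1 - x) ^ 2 * (x * s))
  by (rewrite hT, Hq2, Hode; ring).
replace ((1 - 1) * (z - q2) - (t2 - q2) * (x - 1))
  with (x * (1 - x) * s * (1 - x)) by (rewrite hT, Hq2, Hode; ring).
rewrite !Rabs_pos_eq by (repeat apply Rmult_le_pos; lra || apply pow2_ge_0).
field. lra.
Qed.
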